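(* Any finite diagonal digraph $G$ satisfies property $(\mathcal{V}_2)$: any two shortest paths in $G$ connecting the same vertices are $2$-shortly congruent, and any long path in $G$ is $2$-quasi-reducible.
   Context: A digraph $G$ consists of a set of vertices and a set of arrows, which are ordered pairs of distinct vertices. A path of length $n\ge 0$ is a tuple of vertices $p=(p_0,\dots,p_n)$ such that each $(p_i,p_{i+1})$ is an arrow; $d(x,y)$ is the infimum of lengths of paths from $x$ to $y$ ($\infty$ if there are none). A path $(p_0,\dots,p_n)$ is shortest if $d(p_0,p_n)=n$, and long otherwise. A subpath of $p$ is a path $(p_i,p_{i+1},\dots,p_j)$. Two paths connect the same vertices if they have the same initial and the same terminal vertex. Magnitude homology: put $|x_0,\dots,x_n|=\sum_{i=0}^{n-1}d(x_i,x_{i+1})$. $\mathrm{MC}_{n,\ell}(G,\mathbb{Z})$ is the free abelian group on tuples of vertices with $x_i\neq x_{i+1}$ and $|x_0,\dots,x_n|=\ell$; the differential is $\sum_{i=0}^n(-1)^i\partial_{n,i}$, where $\partial_{n,i}$ deletes $x_i$ if the resulting tuple still has norm $\ell$ and is $0$ otherwise. $\mathrm{MH}_{n,\ell}(G,\mathbb{Z})=H_n(\mathrm{MC}_{\bullet,\ell}(G,\mathbb{Z}))$. The digraph $G$ is diagonal if $\mathrm{MH}_{n,\ell}(G,\mathbb{Z})=0$ for all $\ell\neq n$. An equivalence relation $\sim$ on the set of paths is a congruence if $p\sim\tilde p$ implies that $p,\tilde p$ connect the same vertices and $qpq'\sim q\tilde pq'$ whenever the concatenations are defined. The $2$-short congruence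 is the minimal congruence such that any two shortest paths connecting the same two vertices at distance at most $2$ are equivalent. A long path is $2$-reducible if it contains a long subpath of length at most $2$. A long path is $2$-quasi-reducible if it is $2$-shortly congruent to a $2$-reducible path. *)

(* Defs.v *)
From HB Require Import structures.
From mathcomp Require Import all_boot all_order all_algebra.
From mathcomp Require Import boolp.

Set Implicit Arguments.
Unset Strict Implicit.
Unset Printing Implicit Defensive.

Import GRing.Theory.

(* Lengths with an infinite value: [None] stands for infinity. *)
Definition oadd (a b : option nat) : option nat :=
  if (a, b) is (Some m, Some n) then Some (m + n) else None.

Fact oaddA : associative oadd.
Proof. by move=> [a|] [b|] [c|] //; rewrite /oadd addnA. Qed.
Fact oaddC : commutative oadd.
Proof. by move=> [a|] [b|] //; rewrite /oadd addnC. Qed.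
Fact oadd0 : left_id (Some 0) oadd.
Proof. by case. Qed.
HB.instance Definition _ := Monoid.isComLaw.Build _ (Some 0) oadd oaddA oaddC oadd0.

Definition ole (a : option nat) (k : nat) : bool :=
  if a is Some m then m <= k else false.

Record digraph := Digraph {
  vertex :> finType;
  arrow : rel vertex;
  arrow_irrefl : irreflexive arrow
}.

Section Paths.
Variable G : digraph.
Implicit Types x y z : G.

(* The path (p_0, ..., p_n) is stored as its initial vertex p_0 together with
   the sequence of the remaining vertices p_1, ..., p_n. *)
Record gpath := GPath {
  src : G;
  steps : seq G;
  gpathP : path (@arrow G) src steps
}.

Definition tgt (p : gpath) : G := last (src p) (steps p).
Definition plen (p : gpath) : nat := size (steps p).
Definition verts (p : gpath) : seq G := src p :: steps p.

Definition same_ends (p q : gpath) : Prop := src p = src q /\ tgt p = tgt q.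

Definition walk x y (n : nat) : bool :=
  [exists t : n.-tuple G, path (@arrow G) x t && (last x t == y)].

Lemma walkP x y n :
  reflect (exists p : gpath, [/\ src p = x, tgt p = y & plen p = n])
          (walk x y n).
Proof.
apply: (iffP existsP) => [[t /andP[pt /eqP lt]] | [[a s ps] /= [<- <- <-]]].
  by exists (GPath pt); split=> //; rewrite /plen size_tuple.
by exists (in_tuple s); rewrite ps eqxx.
Qed.

(* The infimum of the lengths of the paths from x to y. *)
Definition dist x y : option nat :=
  match pselect (exists n, walk x y n) with
  | left h => Some (ex_minn h)
  | right _ => None
  end.

Lemma dist_someP x y n :
  dist x y = Some n <-> walk x y n /\ (forall m, walk x y m -> n <= m).
Proof.
rewrite /dist; case: pselect => [h | nh]; last first.
  by split=> // -[wn _]; case: nh; exists n.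
case: ex_minnP => k wk mink; split=> [[<-] // | [wn minn]].
by congr Some; apply/eqP; rewrite eqn_leq mink // minn.
Qed.

Lemma dist_noneP x y : dist x y = None <-> forall n, ~~ walk x y n.
Proof.
rewrite /dist; case: pselect => [h | nh]; split=> //.
  by case: (h) => n wn /(_ n); rewrite wn.
by move=> _ n; apply/negP => wn; apply: nh; exists n.
Qed.

Definition shortest (p : gpath) : bool := dist (src p) (tgt p) == Some (plen p).
Definition long (p : gpath) : bool := ~~ shortest p.

Definition subpath (q p : gpath) : bool := infix (verts q) (verts p).

(* r is the concatenation q p q'; consecutive factors share a vertex. *)
Definition is_concat (q p q' r : gpath) : Prop :=
  [/\ tgt q = src p, tgt p = src q', src r = src q
    & steps r = steps q ++ steps p ++ steps q'].

Record congruence (R : gpath -> gpath -> Prop) : Prop := {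
  cong_refl : forall p, R p p;
  cong_sym : forall p q, R p q -> R q p;
  cong_trans : forall p q r, R p q -> R q r -> R p r;
  cong_ends : forall p q, R p q -> same_ends p q;
  cong_concat : forall p p' q q' r r',
    R p p' -> is_concat q p q' r -> is_concat q p' q' r' -> R r r'
}.

(* The smallest congruence R such that [identifies_short 2 R]: the
   intersection of all of them. *)
Definition identifies_short (k : nat) (R : gpath -> gpath -> Prop) : Prop :=
  forall p q, shortest p -> shortest q -> same_ends p q ->
    ole (dist (src p) (tgt p)) k -> R p q.

Definition short_congruent2 (p q : gpath) : Prop :=
  forall R, congruence R -> identifies_short 2 R -> R p q.

Definition reducible2 (p : gpath) : Prop :=
  long p /\ exists q, [/\ subpath q p, long q & plen q <= 2].

Definition quasi_reducible2 (p : gpath) : Prop :=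
  long p /\ exists q, short_congruent2 p q /\ reducible2 q.

Definition property_V2 : Prop :=
  (forall p q, shortest p -> shortest q -> same_ends p q ->
     short_congruent2 p q) /\
  (forall p, long p -> quasi_reducible2 p).

End Paths.

Section MagnitudeHomology.
Variable G : digraph.
Local Open Scope ring_scope.

Definition tnorm n (x : n.+1.-tuple G) : option nat :=
  \big[oadd/Some 0%N]_(i < n)
    dist (tnth x (widen_ord (leqnSn n) i)) (tnth x (lift ord0 i)).

Definition nondegenerate n (x : n.+1.-tuple G) : bool :=
  [forall i : 'I_n,
    tnth x (widen_ord (leqnSn n) i) != tnth x (lift ord0 i)].

Definition simplex n l :=
  {x : n.+1.-tuple G | nondegenerate x && (tnorm x == Some l)}.

(* The free abelian group on the finite set [simplex n l]. *)
Definition MC n l := {ffun simplex n l -> int}.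

Definition basis n l (x : simplex n l) : MC n l := [ffun y => (y == x)%:R].

Definition delete n (i : 'I_n.+2) (x : n.+2.-tuple G) : n.+1.-tuple G :=
  [tuple tnth x (lift i j) | j < n.+1].

(* [insub] gives [None] unless the tuple with x_i deleted still has norm l.
   When it does, it is automatically nondegenerate: x_(i-1) = x_(i+1) would
   make the norm drop. *)
Definition face n l (i : 'I_n.+2) (x : simplex n.+1 l) : MC n l :=
  oapp (@basis n l) 0 (insub (delete i (val x))).

Definition diffS n l (c : MC n.+1 l) : MC n l :=
  \sum_(x : simplex n.+1 l)
    (\sum_(i < n.+2) face i x *~ ((-1) ^+ i)) *~ c x.

(* The differential out of degree n.  In degree 0 it is the zero map; its
   codomain, which should be the trivial group, is then immaterial. *)
Definition diff n l : MC n l -> MC n.-1 l :=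
  match n return MC n l -> MC n.-1 l with
  | 0 => fun _ => 0
  | n'.+1 => @diffS n' l
  end.

Fact diffS_is_zmod_morphism n l : zmod_morphism (@diffS n l).
Proof.
move=> a b; rewrite /diffS -sumrB; apply: eq_bigr => x _.
by rewrite !ffunE mulrzBr.
Qed.

Fact diff_is_zmod_morphism n l : zmod_morphism (@diff n l).
Proof.
case: n => [|n] a b /=; first by rewrite subr0.
exact: diffS_is_zmod_morphism.
Qed.
HB.instance Definition _ n l :=
  GRing.isZmodMorphism.Build (MC n l) (MC n.-1 l) (@diff n l)
    (@diff_is_zmod_morphism n l).
HB.instance Definition _ n l :=
  GRing.isZmodMorphism.Build (MC n.+1 l) (MC n l) (@diffS n l)
    (@diffS_is_zmod_morphism n l).

Definition is_cycle n l : {pred MC n l} := fun c => diff c == 0.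

Fact is_cycle_zmod_closed n l : zmod_closed (@is_cycle n l).
Proof.
split=> [|a b]; first by rewrite unfold_in raddf0.
rewrite !unfold_in => /eqP da /eqP db.
by rewrite diff_is_zmod_morphism da db subr0.
Qed.
HB.instance Definition _ n l :=
  GRing.isZmodClosed.Build (MC n l) (@is_cycle n l)
    (@is_cycle_zmod_closed n l).

Record cycles n l := Cycle { cycle_val :> MC n l; _ : cycle_val \in @is_cycle n l }.
HB.instance Definition _ n l := [isSub for @cycle_val n l].
HB.instance Definition _ n l := [Choice of cycles n l by <:].
HB.instance Definition _ n l := [SubChoice_isSubZmodule of cycles n l by <:].

(* The differential squares to zero, so every boundary is a cycle; the image
   of the differential is taken directly inside the group of cycles. *)
Definition is_boundary n l : {pred cycles n l} :=
  fun z => `[< exists c : MC n.+1 l, diff c = cycle_val z >].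

Fact is_boundary_zmod_closed n l : zmod_closed (@is_boundary n l).
Proof.
split=> [|a b]; rewrite !unfold_in.
  by apply/asboolP; exists 0; rewrite raddf0.
move=> /asboolP[c dc] /asboolP[e de]; apply/asboolP.
by exists (c - e); rewrite diff_is_zmod_morphism dc de.
Qed.
HB.instance Definition _ n l :=
  GRing.isZmodClosed.Build (cycles n l) (@is_boundary n l)
    (@is_boundary_zmod_closed n l).

Definition MH n l : zmodType := Quotient.quot (@is_boundary n l).

Definition diagonal : Prop :=
  forall n l : nat, l <> n -> forall h : MH n l, h = 0.

End MagnitudeHomology.

(* Main.v *)
Require Import Defs.
From HB Require Import structures.
From mathcomp Require Import all_boot all_order all_algebra.
From mathcomp Require Import boolp.

Set Implicit Arguments.
Unset Strict Implicit.
Unset Printing Implicit Defensive.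

Import GRing.Theory.

(** Only the vanishing of magnitude homology in degree 2 matters, in lengths
    l > 2.  By strong induction on l one proves together that shortest paths of
    length l with the same ends are congruent and that long paths of length l
    are quasi-reducible; for l <= 2 this holds by definition.

    Let p be a path of length l > 2 that is not quasi-reducible.  Declare the
    value of a triple (x, y, w) to be 1 if p is congruent to a concatenation of
    nontrivial shortest paths from x to y and from y to w, and 0 otherwise.  By
    induction the choice of these two shortest paths is irrelevant, and the
    resulting 2-cochain [factor_cochain p] kills boundaries: in the boundary of
    (x, y, z, w) only the triples (x, z, w) and (x, y, w) can have value 1, and
    each of them does exactly when p is congruent to a concatenation of shortest
    paths x -> y -> z -> w ([factors_at_shift]).  The point is that a factor
    such as x -> y -> z is then shortest, for otherwise it would be
    quasi-reducible by induction, and so would p.  Since homology vanishes, the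
    cochain kills all cycles ([factor_cochain_cycle]).

    Now cut the first arrow (x, y) off p, which ends at w.
    - If p is long, its two pieces are shortest by induction, and (x, y, w) is a
      cycle, as deleting y shortens it.  Its value is 1: a contradiction, so
      p is quasi-reducible ([qred_of_long_step]).
    - If p is shortest, it is not quasi-reducible.  Let q be a shortest path
      from x to w and (x, y') its first arrow.  Then (x, y, w) - (x, y', w) is a
      cycle, as deleting the middle vertex gives (x, w) on both sides.  Hence
      (x, y', w) has value 1, and p is congruent to q
      ([scong_of_shortest_step]).

    This is the argument that a Koszul algebra is quadratic, unwound for the
    algebra of pairs of vertices at finite distance. *)

(** * Concatenation of paths *)

Section PathCalculus.
Variable G : digraph.
Implicit Types (x y z : G) (p q r u v a b : gpath G).

Lemma gpath_eq p q : src p = src q -> steps p = steps q -> p = q.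
Proof.
case: p q => [x s ps] [y t pt] /= xy st; subst y t.
by congr GPath; apply: bool_irrelevance.
Qed.

Definition pnil x : gpath G := @GPath G x [::] isT.

Lemma pcat_subproof u v :
  path (@arrow G) (src u) (steps u ++ if tgt u == src v then steps v else [::]).
Proof.
rewrite cat_path (gpathP u) /=; case: eqP => [|_] //; rewrite /tgt => ->.
exact: gpathP.
Qed.

(** Making concatenation total, with junk value [u] when the ends do not match,
    keeps proofs of composability out of the terms. *)
Definition pcat u v : gpath G := GPath (pcat_subproof u v).

Lemma src_pcat u v : src (pcat u v) = src u.
Proof. by []. Qed.

Lemma steps_pcat u v : tgt u = src v -> steps (pcat u v) = steps u ++ steps v.
Proof. by move=> /= ->; rewrite eqxx. Qed.

Lemma tgt_pcat u v : tgt u = src v -> tgt (pcat u v) = tgt v.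
Proof. by move=> uv; rewrite /tgt steps_pcat //= last_cat -/(tgt u) uv. Qed.

Lemma plen_pcat u v : tgt u = src v -> plen (pcat u v) = plen u + plen v.
Proof. by move=> uv; rewrite /plen steps_pcat // size_cat. Qed.

Lemma pcatA a u v : tgt a = src u -> tgt u = src v ->
  pcat a (pcat u v) = pcat (pcat a u) v.
Proof.
move=> au uv; apply: gpath_eq => //.
by rewrite !steps_pcat ?tgt_pcat // catA.
Qed.

Lemma pcatp0 u : pcat u (pnil (tgt u)) = u.
Proof. by apply: gpath_eq => //; rewrite steps_pcat //= cats0. Qed.

Lemma pcat0p u : pcat (pnil (src u)) u = u.
Proof. by apply: gpath_eq => //; rewrite steps_pcat. Qed.

Lemma pcat_split p : 0 < plen p -> exists u v,
  [/\ tgt u = src v, p = pcat u v, plen u = 1 & plen v = (plen p).-1].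
Proof.
case: p => x [|y s] // ps _; have /= /andP[xy sy] := ps.
have xy1 : path (@arrow G) x [:: y] by rewrite /= xy.
exists (GPath xy1), (GPath sy); split=> //.
by apply: gpath_eq => //; rewrite steps_pcat.
Qed.

Lemma shortestP p :
  reflect (forall q, same_ends q p -> plen p <= plen q) (shortest p).
Proof.
apply: (iffP eqP) => [/dist_someP[_ minp] q [sq tq] | minp].
  by apply: minp; apply/walkP; exists q.
apply/dist_someP; split=> [|m /walkP[q [sq tq <-]]].
  by apply/walkP; exists p.
exact: minp.
Qed.

Lemma shortest_dist p : shortest p -> dist (src p) (tgt p) = Some (plen p).
Proof. by move/eqP. Qed.

Lemma dist_shortest x y n : dist x y = Some n ->
  exists p, [/\ src p = x, tgt p = y, plen p = n & shortest p].
Proof.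
move=> dxy; have /dist_someP[/walkP[p [sp tp lp]] _] := dxy.
by exists p; split=> //; apply/eqP; rewrite sp tp lp.
Qed.

Lemma dist_eq0 x y : (dist x y == Some 0) = (x == y).
Proof.
apply/eqP/eqP => [/dist_shortest[p [<- <- /size0nil p0 _]] | ->].
  by rewrite /tgt p0.
by apply/dist_someP; split=> //; apply/walkP; exists (pnil y).
Qed.

(** A shorter replacement of one factor would shorten the concatenation. *)
Lemma shortest_pcat u v :
  tgt u = src v -> shortest (pcat u v) -> shortest u /\ shortest v.
Proof.
move=> uv /shortestP minuv; split; apply/shortestP => q [sq tq].
  have qv : tgt q = src v by rewrite tq.
  have := minuv (pcat q v); rewrite !plen_pcat // leq_add2r; apply.
  by split; rewrite ?tgt_pcat.
have uq : tgt u = src q by rewrite sq.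
have := minuv (pcat u q); rewrite !plen_pcat // leq_add2l; apply.
by split; rewrite ?tgt_pcat.
Qed.

End PathCalculus.

Arguments shortest_pcat {G u v}.

(** * The 2-short congruence and quasi-reducibility *)

Section ShortCongruence.
Variable G : digraph.
Implicit Types (x y z w : G) (p q r u v a b : gpath G).

(** An intersection of congruences is a congruence; the ends are preserved
    because having the same ends is one of the congruences intersected. *)
Lemma scong_congruence : congruence (@short_congruent2 G).
Proof.
split.
- by move=> p R [Rr _ _ _ _] _; apply: Rr.
- by move=> p q pq R cR iR; have [_ Rs _ _ _] := cR; exact: Rs (pq R cR iR).
- move=> p q r pq qr R cR iR; have [_ _ Rt _ _] := cR.
  exact: (Rt _ _ _ (pq R cR iR) (qr R cR iR)).
- move=> p q pq; apply: (pq (@same_ends G)); last by move=> p' q' _ _ pq' _.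
  split=> [p' | p' q' [] | p' q' r' [sp tp] [sq tq] | | p' q' a b r r'] //.
    by split; rewrite ?sp ?tp.
  case=> sp tp [ta tp' sr er] [ta' tq' sr' er'].
  rewrite /same_ends /tgt sr sr' er er' !last_cat.
  by rewrite -/(tgt a) ta -/(tgt p') sp -/(tgt q') tp.
- move=> p p' q q' r r' pp' c c' R cR iR; have [_ _ _ _ Rc] := cR.
  exact: (Rc _ _ _ _ _ _ (pp' R cR iR) c c').
Qed.

Lemma scong_refl p : short_congruent2 p p.
Proof. exact: cong_refl scong_congruence _. Qed.

Lemma scong_sym p q : short_congruent2 p q -> short_congruent2 q p.
Proof. exact: cong_sym scong_congruence _ _. Qed.

Lemma scong_trans q p r :
  short_congruent2 p q -> short_congruent2 q r -> short_congruent2 p r.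
Proof. exact: cong_trans scong_congruence _ _ _. Qed.

Lemma scong_ends p q : short_congruent2 p q -> same_ends p q.
Proof. exact: cong_ends scong_congruence _ _. Qed.

Lemma scong_short p q : shortest p -> shortest q -> same_ends p q ->
  plen p <= 2 -> short_congruent2 p q.
Proof.
by move=> sp sq pq p2 R _; apply=> //; rewrite shortest_dist.
Qed.

(** Having equal ends and equal lengths is a congruence, and it identifies
    shortest paths with the same ends. *)
Lemma scong_plen p q : short_congruent2 p q -> plen p = plen q.
Proof.
move=> pq; pose R p q := same_ends p q /\ plen p = plen q :> nat.
suff : R p q by case.
apply: pq.
- split=> [p' | p' q' [[]] | p' q' r' [[sp tp] lp] [[sq tq] lq] | p' q' [] |
    p' q' a b r r'] //.
    by split; [split|]; rewrite ?sp ?tp ?lp.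
  case=> [[sp tp] lp] [ta tp' sr er] [ta' tq' sr' er'].
  rewrite /R /same_ends /tgt /plen sr sr' er er' !last_cat.
  rewrite -/(tgt a) ta -/(tgt p') sp -/(tgt q') tp; split=> //.
  by rewrite !size_cat -/(plen p') -/(plen q') lp.
- move=> p' q' /shortest_dist sp /shortest_dist sq pq _; split=> //.
  by case: pq sp => -> ->; rewrite sq => -[].
Qed.

Lemma scong_pcatl u u' v : tgt u = src v ->
  short_congruent2 u u' -> short_congruent2 (pcat u v) (pcat u' v).
Proof.
move=> uv uu'; have [su tu] := scong_ends uu'.
apply: (cong_concat scong_congruence uu' (q := pnil (src u)) (q' := v)).
  by split=> //; rewrite steps_pcat.
by split=> //; rewrite -?tu //= -tu uv eqxx.
Qed.

Lemma scong_pcatr u v v' : tgt u = src v ->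
  short_congruent2 v v' -> short_congruent2 (pcat u v) (pcat u v').
Proof.
move=> uv vv'; have [sv tv] := scong_ends vv'.
apply: (cong_concat scong_congruence vv' (q := u) (q' := pnil (tgt v))).
  by split=> //; rewrite steps_pcat ?cats0.
by split; rewrite // ?steps_pcat -?sv ?cats0.
Qed.

Lemma scong_shortest p q : short_congruent2 p q -> shortest p = shortest q.
Proof.
by move=> pq; rewrite /shortest (scong_plen pq); case: (scong_ends pq) => -> ->.
Qed.

(** Quasi-reducibility, with the long subpath displayed as a factor; this form
    is visibly stable under concatenation. *)
Definition qred p := exists a q b,
  [/\ tgt a = src q, tgt q = src b, long q, plen q <= 2
    & short_congruent2 p (pcat a (pcat q b))].

Lemma qred_scong p p' : short_congruent2 p p' -> qred p' -> qred p.
Proof.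
move=> pp' [a [q [b [aq qb lq q2 p'E]]]].
by exists a, q, b; split=> //; apply: scong_trans p'E.
Qed.

Lemma qred_pcatr u v : tgt u = src v -> qred v -> qred (pcat u v).
Proof.
move=> uv [a [q [b [aq qb lq q2 vE]]]]; have [sv _] := scong_ends vE.
have ua : tgt u = src a by rewrite uv sv.
exists (pcat u a), q, b; split; rewrite ?tgt_pcat // -pcatA ?src_pcat //.
exact: scong_pcatr.
Qed.

Lemma qred_pcatl u v : tgt u = src v -> qred u -> qred (pcat u v).
Proof.
move=> uv [a [q [b [aq qb lq q2 uE]]]]; have [_] := scong_ends uE.
rewrite !tgt_pcat // uv => vb.
exists a, q, (pcat b v); split=> //.
rewrite (pcatA qb) // pcatA ?tgt_pcat //.
exact: scong_pcatl.
Qed.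

(** Congruence preserves length and ends, hence shortestness, and factors of
    shortest paths are shortest. *)
Lemma qred_long p : qred p -> long p.
Proof.
move=> [a [q [b [aq qb lq q2 pE]]]]; rewrite /long (scong_shortest pE).
apply: contra lq => /shortest_pcat[] // _ /shortest_pcat[] //.
Qed.

Lemma qred_short p : long p -> plen p <= 2 -> qred p.
Proof.
move=> lp p2; exists (pnil (src p)), p, (pnil (tgt p)); split=> //.
by rewrite pcatp0 pcat0p; apply: scong_refl.
Qed.

Lemma qred_quasi_reducible2 p : qred p -> quasi_reducible2 p.
Proof.
move=> qp; have lp := qred_long qp; split=> //.
case: qp => a [q [b [aq qb lq q2 pE]]].
exists (pcat a (pcat q b)); split=> //; split.
  by rewrite /long -(scong_shortest pE).
exists q; split=> //; apply/infixP.
exists (belast (src a) (steps a)), (steps b).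
rewrite /verts src_pcat !steps_pcat ?src_pcat //.
by rewrite -cat_cons lastI -/(tgt a) aq cat_rcons.
Qed.

End ShortCongruence.

(** * Evaluating cochains on magnitude chains *)

Section Cochains.
Variable G : digraph.
Local Open Scope ring_scope.

Definition is_simplex n l (t : n.+1.-tuple G) :=
  Defs.nondegenerate t && (tnorm t == Some l).

Definition ceval n l (f : n.+1.-tuple G -> int) (c : MC G n l) : int :=
  \sum_(s : simplex G n l) c s * f (val s).

Lemma ceval0 n l f : ceval f (0 : MC G n l) = 0.
Proof. by apply: big1 => s _; rewrite ffunE mul0r. Qed.

Lemma cevalB n l f (c e : MC G n l) : ceval f (c - e) = ceval f c - ceval f e.
Proof.
by rewrite /ceval -sumrB; apply: eq_bigr => s _; rewrite !ffunE mulrBl.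
Qed.

HB.instance Definition _ n l f :=
  GRing.isZmodMorphism.Build (MC G n l) int (@ceval n l f) (@cevalB n l f).

Lemma ceval_basis n l f (s : simplex G n l) : ceval f (basis s) = f (val s).
Proof.
rewrite /ceval (bigD1 s) //= big1 => [|t /negPf ts].
  by rewrite addr0 ffunE eqxx mul1r.
by rewrite ffunE ts mul0r.
Qed.

(** A face is set to zero when deleting a vertex lowers the norm; a function
    supported on simplices also vanishes there, so it sees every face as a plain
    deletion. *)
Lemma ceval_face n l f i (s : simplex G n.+1 l) :
    (forall t, f t != 0 -> is_simplex l t) ->
  ceval f (face i s) = f (delete i (val s)).
Proof.
move=> fl; rewrite /face; case: insubP => [t _ <- | nt] /=.
  exact: ceval_basis.
rewrite ceval0; apply/esym/eqP/negPn; apply: contra nt; exact: fl.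
Qed.

Lemma ceval_diffS n l f (c : MC G n.+1 l) :
    (forall t, f t != 0 -> is_simplex l t) ->
  ceval f (diffS c) = ceval
    (fun t : n.+2.-tuple G => \sum_(i < n.+2) (-1) ^+ i * f (delete i t)) c.
Proof.
move=> fl; rewrite /diffS raddf_sum; apply: eq_bigr => s _.
rewrite raddfMz raddf_sum -mulrzr mulrC intz; congr (_ * _).
apply: eq_bigr => i _; rewrite raddfMz -mulrzr mulrC intz; congr (_ * _).
exact: ceval_face.
Qed.

Lemma diffS_basis n l (s : simplex G n.+1 l) :
  diffS (basis s) = \sum_(i < n.+2) face i s *~ ((-1) ^+ i).
Proof.
rewrite /diffS (bigD1 s) //= [X in _ + X]big1 => [|t /negPf ts].
  by rewrite addr0 ffunE eqxx mulr1z.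
by rewrite ffunE ts mulr0z.
Qed.

Lemma diagonal_exact n l (c : MC G n l) : diagonal G -> l <> n ->
  diff c = 0 -> exists e : MC G n.+1 l, diffS e = c.
Proof.
move=> dG ln dc.
have cc : c \in @is_cycle G n l by rewrite unfold_in dc.
have /eqP := dG n l ln (\pi_(MH G n l) (Cycle cc))%qT.
rewrite -(raddf0 (\pi_(MH G n l))%qT) -Quotient.idealrBE subr0 unfold_in.
by move/asboolP.
Qed.

End Cochains.

(** * Simplices with two, three and four vertices *)

Section SmallSimplices.
Variable G : digraph.
Implicit Types (x y z w : G).

Lemma nondegenerateE n (t : n.+1.-tuple G) :
  Defs.nondegenerate t = \big[andb/true]_(i < n)
    (tnth t (widen_ord (leqnSn n) i) != tnth t (lift ord0 i)).
Proof. by rewrite big_andE. Qed.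

Lemma is_simplex2 l x y :
  is_simplex l [tuple x; y] = (x != y) && (dist x y == Some l).
Proof.
rewrite /is_simplex nondegenerateE /tnorm !big_ord_recl !big_ord0.
by rewrite !(tnth_nth x) /= !Monoid.mulm1.
Qed.

Lemma is_simplex3 l x y z :
  is_simplex l [tuple x; y; z] =
    [&& x != y, y != z & oadd (dist x y) (dist y z) == Some l].
Proof.
rewrite /is_simplex nondegenerateE /tnorm !big_ord_recl !big_ord0.
by rewrite !(tnth_nth x) /= !Monoid.mulm1 andbA.
Qed.

Lemma is_simplex4 l x y z w :
  is_simplex l [tuple x; y; z; w] =
    [&& x != y, y != z, z != w
      & oadd (dist x y) (oadd (dist y z) (dist z w)) == Some l].
Proof.
rewrite /is_simplex nondegenerateE /tnorm !big_ord_recl !big_ord0.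
by rewrite !(tnth_nth x) /= !Monoid.mulm1 !andbA.
Qed.

Lemma delete3 x y z :
  [/\ delete ord0 [tuple x; y; z] = [tuple y; z],
      delete (lift ord0 ord0) [tuple x; y; z] = [tuple x; z]
    & delete (lift ord0 (lift ord0 ord0)) [tuple x; y; z] = [tuple x; y]].
Proof.
by split; apply: eq_from_tnth => -[[|[|]]] // ?; rewrite tnth_mktuple !(tnth_nth x).
Qed.

Lemma delete4 x y z w :
  [/\ delete ord0 [tuple x; y; z; w] = [tuple y; z; w],
      delete (lift ord0 ord0) [tuple x; y; z; w] = [tuple x; z; w],
      delete (lift ord0 (lift ord0 ord0)) [tuple x; y; z; w] = [tuple x; y; w]
    & delete (lift ord0 (lift ord0 (lift ord0 ord0))) [tuple x; y; z; w]
        = [tuple x; y; z]].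
Proof.
by split; apply: eq_from_tnth => -[[|[|[|]]]] // ?;
  rewrite tnth_mktuple !(tnth_nth x).
Qed.

Lemma simplex4P l (s : simplex G 3 l) :
  exists x y z w, val s = [tuple x; y; z; w].
Proof.
case: s => -[[|x [|y [|z [|w []]]]] // xs] /= _; exists x, y, z, w.
exact: val_inj.
Qed.

Lemma face_nonsimplex n l i (s : simplex G n.+1 l) :
  ~~ is_simplex l (delete i (val s)) -> face i s = 0%R.
Proof. by rewrite /face => ns; rewrite insubN. Qed.

(** Deleting an end vertex loses a positive distance, so the outer faces of a
    simplex vanish. *)
Lemma oadd_dist_neq x y o l :
  x != y -> oadd (dist x y) o = Some l -> o != Some l.
Proof.
rewrite -dist_eq0; case: (dist x y) o => [m|] [n|] //= m0 [<-].
apply: contra m0 => /eqP[/esym/eqP]; rewrite -[X in _ == X]add0n eqn_add2r.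
by move/eqP ->.
Qed.

End SmallSimplices.

(** * The cochain of a path that is not quasi-reducible *)

Section FactorCochain.
Variable G : digraph.
Implicit Types (x y z w : G) (p q u v a b : gpath G).

(** Nontriviality of both factors is what makes (x, y, w) nondegenerate. *)
Definition factors_at p x y w := exists u v,
  [/\ tgt u = src v, shortest u, shortest v, 0 < plen u & 0 < plen v] /\
  [/\ src u = x, src v = y, tgt v = w & short_congruent2 (pcat u v) p].

Definition factor_cochain p (t : 3.-tuple G) : int :=
  if tval t is [:: x; y; w] then (`[< factors_at p x y w >]%:R)%R else 0%R.

Lemma shortest_neq p : shortest p -> (src p == tgt p) = (plen p == 0).
Proof. by move/shortest_dist; rewrite -dist_eq0 => ->. Qed.

Lemma eq_plen_shortest p q :
  shortest p -> same_ends q p -> plen q = plen p -> shortest q.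
Proof. by rewrite /shortest => sp [-> ->] ->. Qed.

(** The norm of (x, y, w) is the sum of the lengths of the two shortest factors,
    and congruent paths have equal lengths. *)
Lemma factors_at_simplex p x y w :
  factors_at p x y w -> is_simplex (plen p) [tuple x; y; w].
Proof.
move=> [u [v [[uv su sv u0 v0] [<- <- <- uvp]]]].
rewrite is_simplex3 -{1 3}uv !shortest_neq // -!lt0n u0 v0 /=.
by rewrite !shortest_dist //= -(scong_plen uvp) plen_pcat.
Qed.

Lemma factor_cochain_simplex p t :
  (factor_cochain p t != 0)%R -> is_simplex (plen p) t.
Proof.
case: t => -[|x [|y [|z []]]] // xs.
rewrite /factor_cochain /=; case: asboolP => // /factors_at_simplex xyz _.
by rewrite (_ : Tuple xs = [tuple x; y; z]) //; apply: val_inj.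
Qed.

(** The induction hypothesis.  Shortest paths with the same ends have the same
    length, so it suffices to bound the length of [p]. *)
Definition V2_below (l : nat) : Prop :=
  (forall p q, plen p < l -> shortest p -> shortest q -> same_ends p q ->
     short_congruent2 p q) /\
  (forall p, plen p < l -> long p -> qred p).

(** Both sides say that [p] is congruent to a concatenation of shortest paths
    from x to y, from y to z and from z to w.  The merged factor of either side
    is shorter than [p]: it may be replaced by any shortest path with its ends,
    and a long one would make [p] quasi-reducible. *)
Lemma factors_at_shift p x y z w :
    V2_below (plen p) -> ~ qred p ->
    is_simplex (plen p) [tuple x; y; z; w] ->
  factors_at p x z w <-> factors_at p x y w.
Proof.
move=> [V2s V2l] nqp; rewrite is_simplex4 => /and4P[xy yz zw].
case dxy: (dist x y) => [i|//]; case dyz: (dist y z) => [j|//].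
case dzw: (dist z w) => [k|//] /eqP[lE].
have i0 : 0 < i.
  by rewrite lt0n; apply: contra xy; rewrite -dist_eq0 dxy => /eqP->.
have j0 : 0 < j.
  by rewrite lt0n; apply: contra yz; rewrite -dist_eq0 dyz => /eqP->.
have k0 : 0 < k.
  by rewrite lt0n; apply: contra zw; rewrite -dist_eq0 dzw => /eqP->.
have [a [sa ta la ga]] := dist_shortest dxy.
have [b [sb tb lb gb]] := dist_shortest dyz.
have [c [sc tc lc gc]] := dist_shortest dzw.
have ab : tgt a = src b by rewrite ta.
have bc : tgt b = src c by rewrite tb.
split=> -[u [v [[uv gu gv u0 v0] [su sv tv uvp]]]].
(* From (x, z, w): split the first factor at y, then merge its second half
   with the last factor. *)
- have lv : plen v = k.
    by apply: Some_inj; rewrite -dzw -shortest_dist // sv tv.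
  have lab : plen (pcat a b) = plen u.
    move: (scong_plen uvp); rewrite !plen_pcat // la lb lv -lE addnA.
    by move/addIn.
  have eab : same_ends (pcat a b) u.
    by split; rewrite ?tgt_pcat // ?sa ?su ?tb ?uv ?sv.
  have abu : short_congruent2 (pcat a b) u.
    apply: V2s => //; last exact: eq_plen_shortest gu _ _.
    by rewrite plen_pcat // la lb -lE addnA -ltn_subLR ?subnn.
  have bv : tgt b = src v by rewrite tb.
  have abvp : short_congruent2 (pcat a (pcat b v)) p.
    rewrite pcatA //; apply: scong_trans uvp; apply: scong_pcatl => //.
    by rewrite tgt_pcat.
  exists a, (pcat b v); split; split; rewrite ?plen_pcat ?tgt_pcat ?la ?lb //.
    apply: contrapT => /negP lbv; apply: nqp.
    apply: qred_scong (scong_sym abvp) _; apply: qred_pcatr => //.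
    by apply: V2l => //; rewrite plen_pcat // lb lv -lE -[ltnLHS]add0n ltn_add2r.
  by rewrite addn_gt0 j0.
(* From (x, y, w): split the second factor at z, then merge its first half
   with the first factor. *)
- have lu : plen u = i.
    by apply: Some_inj; rewrite -dxy -shortest_dist // uv su sv.
  have lbc : plen (pcat b c) = plen v.
    by move: (scong_plen uvp); rewrite !plen_pcat // lb lc lu -lE => /addnI.
  have ebc : same_ends (pcat b c) v.
    by split; rewrite ?tgt_pcat // ?sb ?sv ?tc ?tv.
  have bcv : short_congruent2 (pcat b c) v.
    apply: V2s => //; last exact: eq_plen_shortest gv _ _.
    by rewrite plen_pcat // lb lc -lE -[ltnLHS]add0n ltn_add2r.
  have ub : tgt u = src b by rewrite uv sv.
  have ubcp : short_congruent2 (pcat (pcat u b) c) p.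
    rewrite -pcatA //; apply: scong_trans uvp; apply: scong_pcatr => //.
  exists (pcat u b), c; split; split; rewrite ?plen_pcat ?tgt_pcat ?lb ?lc //.
    apply: contrapT => /negP lub; apply: nqp.
    apply: qred_scong (scong_sym ubcp) _; apply: qred_pcatl; rewrite ?tgt_pcat //.
    apply: V2l => //.
    by rewrite plen_pcat // lb lu -lE addnA -[ltnLHS]addn0 ltn_add2l.
  by rewrite addn_gt0 j0 orbT.
Qed.

Local Open Scope ring_scope.

(** The outer faces vanish and the two inner ones, of opposite signs, have equal
    values by [factors_at_shift]. *)
Lemma factor_cochain_boundary p (e : MC G 3 (plen p)) :
  V2_below (plen p) -> ~ qred p -> ceval (factor_cochain p) (diffS e) = 0.
Proof.
move=> V2 nqp; rewrite ceval_diffS; last exact: factor_cochain_simplex.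
apply: big1 => s _; have [x [y [z [w sE]]]] := simplex4P s.
have := valP s; rewrite sE -/(is_simplex _ _) => ss.
have [d0 d1 d2 d3] := delete4 x y z w.
rewrite !big_ord_recl big_ord0 d0 d1 d2 d3.
have f0 t : ~~ is_simplex (plen p) t -> factor_cochain p t = 0.
  by move=> nt; apply/eqP/negPn; apply: contra nt => /factor_cochain_simplex.
have := ss; rewrite is_simplex4 => /and4P[xy yz zw /eqP sl].
rewrite (f0 [tuple y; z; w]); last first.
  by rewrite is_simplex3 yz zw /=; apply: oadd_dist_neq sl.
rewrite (f0 [tuple x; y; z]); last first.
  rewrite is_simplex3 xy yz /=; apply: oadd_dist_neq zw _.
  by rewrite oaddC -oaddA.
rewrite /factor_cochain /= (asbool_equiv_eq (factors_at_shift V2 nqp ss)).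
by rewrite !(mulr0, add0r, addr0) /= expr1 sqrrN expr1n mulN1r mul1r addNr mulr0.
Qed.

Lemma factor_cochain_cycle p (c : MC G 2 (plen p)) :
    diagonal G -> (2 < plen p)%N -> V2_below (plen p) -> ~ qred p ->
  diffS c = 0 -> ceval (factor_cochain p) c = 0.
Proof.
move=> dG p2 V2 nqp dc.
have ln : plen p <> 2%N by apply/eqP; rewrite gtn_eqF.
have [e <-] := diagonal_exact dG ln (dc : diff c = 0).
exact: factor_cochain_boundary.
Qed.

Lemma diffS_basis3 l (s : simplex G 2 l) x y z :
  val s = [tuple x; y; z] -> diffS (basis s) = - face (lift ord0 ord0) s.
Proof.
move=> sE; have := valP s; rewrite sE -/(is_simplex _ _) is_simplex3.
move=> /and3P[xy yz /eqP sl]; have [d0 d1 d2] := delete3 x y z.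
rewrite diffS_basis !big_ord_recl big_ord0 (@face_nonsimplex _ _ _ ord0).
  rewrite (@face_nonsimplex _ _ _ (lift ord0 (lift ord0 ord0))).
    by rewrite !mul0rz add0r !addr0 /= expr1 mulrN1z.
  rewrite sE d2 is_simplex2 xy /=; apply: oadd_dist_neq yz _.
  by rewrite oaddC.
rewrite sE d0 is_simplex2 yz /=; exact: oadd_dist_neq sl.
Qed.

End FactorCochain.

(** * The induction on length *)

Section Induction.
Variable G : digraph.
Implicit Types (p q u v : gpath G).

(** The cochain of [p] takes equal values on the triples cut out by the first
    arrows of [p] and of [q], as the difference of these triples is a cycle. *)
Lemma scong_of_shortest_step p q :
    diagonal G -> 2 < plen p -> V2_below G (plen p) ->
  shortest p -> shortest q -> same_ends p q -> short_congruent2 p q.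
Proof.
move=> dG p2 V2 sp sq pq; have [V2s V2l] := V2.
have nqp : ~ qred p by move/qred_long; rewrite /long sp.
have lpq : plen p = plen q.
  by apply: Some_inj; rewrite -!shortest_dist //; case: pq => -> ->.
have factors r : 2 < plen r -> shortest r -> exists u v,
  [/\ tgt u = src v, r = pcat u v & factors_at r (src u) (src v) (tgt v)].
  move=> r2 sr; have [|u [v [uv rE lu lv]]] := @pcat_split G r.
    by case: plen r2.
  move: sr; rewrite {1}rE => /(shortest_pcat uv)[su sv].
  exists u, v; split=> //; exists u, v; split; split=> //.
  - by rewrite lu.
  - by rewrite lv -subn1 subn_gt0 ltnW.
  - by rewrite -rE; apply: scong_refl.
have [u [v [uv pE fp]]] := factors p p2 sp.
have [|u' [v' [uv' qE fq]]] := factors q _ sq; first by rewrite -lpq.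
pose s := Sub _ (factors_at_simplex fp) : simplex G 2 (plen p).
have fq' : is_simplex (plen p) [tuple src u'; src v'; tgt v'].
  by rewrite lpq factors_at_simplex.
pose s' := Sub _ fq' : simplex G 2 (plen p).
have [sE tE] : src u = src u' /\ tgt v = tgt v'.
  by case: pq; rewrite pE qE !tgt_pcat.
have ds : (diffS (basis s - basis s') = 0)%R.
  rewrite raddfB /= (@diffS_basis3 _ _ s (src u) (src v) (tgt v)) //.
  rewrite (@diffS_basis3 _ _ s' (src u') (src v') (tgt v')) //.
  apply/eqP; rewrite opprK addrC subr_eq0 /face /=.
  have [_ -> _] := delete3 (src u) (src v) (tgt v).
  by have [_ -> _] := delete3 (src u') (src v') (tgt v'); rewrite sE tE.
have := factor_cochain_cycle dG p2 V2 nqp ds.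
rewrite raddfB /= !ceval_basis /factor_cochain /= (asboolT fp).
(* If p did not factor at the first arrow of q, the evaluation would read
   1 - 0 = 0. *)
case: asboolP => // -[u1 [v1 [[uv1 su1 sv1 u10 v10] [e1 e2 e3 uvp]]]] _.
have l1 := scong_plen uvp; rewrite plen_pcat // in l1.
apply: scong_trans (scong_sym uvp) _; rewrite qE.
have su': shortest u' /\ shortest v' by apply: shortest_pcat => //; rewrite -qE.
have uu : short_congruent2 u1 u'.
  apply: V2s => //; last 1 first.
    by split; rewrite // uv1 uv' e2.
    by rewrite -l1 -addn1 leq_add2l.
  by case: su'.
apply: (@scong_trans _ (pcat u' v1)); first exact: scong_pcatl.
apply: scong_pcatr; first by rewrite uv' e2.
apply: V2s => //; first by rewrite -l1 -[ltnLHS]add0n ltn_add2r.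
by case: su'.
Qed.

(** Otherwise the triple cut out by the first arrow of [p] is a cycle on which
    the cochain of [p] has value 1. *)
Lemma qred_of_long_step p : diagonal G -> 2 < plen p -> V2_below G (plen p) ->
  long p -> qred p.
Proof.
move=> dG p2 V2 lp; have [V2s V2l] := V2; apply: contrapT => nqp.
have [|u [v [uv pE lu lv]]] := @pcat_split G p; first by case: plen p2.
have su : shortest u.
  apply: contrapT => /negP nu; apply: nqp; rewrite pE; apply: qred_pcatl => //.
  by apply: V2l => //; rewrite lu ltnW.
have sv : shortest v.
  apply: contrapT => /negP nv; apply: nqp; rewrite pE; apply: qred_pcatr => //.
  by apply: V2l => //; rewrite lv prednK // ltnW // ltnW.
have fp : factors_at p (src u) (src v) (tgt v).
  exists u, v; split; split=> //.
  - by rewrite lu.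
  - by rewrite lv -subn1 subn_gt0 ltnW.
  - by rewrite -pE; apply: scong_refl.
pose s := Sub _ (factors_at_simplex fp) : simplex G 2 (plen p).
have ds : (diffS (basis s) = 0)%R.
  rewrite (@diffS_basis3 _ _ s (src u) (src v) (tgt v)) //.
  rewrite face_nonsimplex ?oppr0 //=.
  have [_ -> _] := delete3 (src u) (src v) (tgt v).
  rewrite is_simplex2 negb_and; apply/orP; right; move: lp.
  by rewrite /long /shortest {1 2}pE tgt_pcat.
have := factor_cochain_cycle dG p2 V2 nqp ds.
by rewrite ceval_basis /factor_cochain /= (asboolT fp).
Qed.

Lemma V2_below_all : diagonal G -> forall l, V2_below G l.
Proof.
move=> dG; elim=> [|l IHl]; first by split.
have [V2s V2l] := IHl; split=> [p q | p];
  rewrite ltnS leq_eqVlt => /orP[/eqP lE|].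
- move=> sp sq pq; have [p2|p2] := leqP (plen p) 2; first exact: scong_short.
  by apply: scong_of_shortest_step => //; rewrite lE.
- exact: V2s.
- move=> lp; have [p2|p2] := leqP (plen p) 2; first exact: qred_short.
  by apply: qred_of_long_step => //; rewrite lE.
- exact: V2l.
Qed.

End Induction.

Theorem corollary4p11 (G : digraph) : diagonal G -> property_V2 G.
Proof.
move=> dG; split=> [p q sp sq pq | p lp].
  by have [+ _] := V2_below_all dG (plen p).+1; apply.
by have [_ V2l] := V2_below_all dG (plen p).+1; apply/qred_quasi_reducible2/V2l.
Qed.
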